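(* Let $ s ( n ) $ be an integer sequence with some non-zero term, $ d $ a positive integer, $ \alpha_1 , \ldots , \alpha_d $ rational numbers with $ \alpha_d \neq 0 $, such that $ s ( n + d ) + \alpha_1 s ( n + d - 1 ) + \ldots + \alpha_d s ( n ) = 0 $ for every integer $ n \geq 0 $. Then there are four integers $ b_1 \geq 2 $, $ b_2 \geq 8 $, $ c \geq 0 $ and $ m \geq 3 $ such that, setting $ t(n) := s(n) + c^{n+1} $ and letting $ R $ be the radius of convergence at zero of $ \mathrm{GF}_t(z) $: every term of $t(n)$ is non-negative, some term of $t(n)$ is positive, $\mathrm{GF}_t(z) \in \mathbb{Q}(z)$, $ b_1^{-m} < R $, $ t(n) < b_1^{n-2} $ for every integer $ n \geq m $, $ b_2^{-1} < R $, and $ t(n) < b_2^{n/3} $ for every integer $ n \geq 1 $. Consequently, writing $ \mathrm{GF}_t(z) = ( A_+ ( z ) - A_- ( z ) ) / ( B_+ ( z ) - B_- ( z ) ) $ as an irreducible fraction with $ A_\pm, B_\pm \in \mathbb{N}[z] $ and $ B_-(0) < B_+(0) $, and setting $ h = \deg ( B_+ - B_- ) $ and \[ E ( n, b ) = \left \lfloor \frac{\max\left( b^{n^2 + h n} A_+(b^{- n}) - b^{n^2 + h n} A_-(b^{- n}) ,\, 0 \right)}{\max\left( b^{h n} B_+(b^{- n}) - b^{h n} B_-(b^{- n}) ,\, 0\right)} \right \rfloor \bmod b^n , \] one has $ s ( r ) = E ( r , b_1 ) - c^{r + 1} $ for every integer $ r \geq m $ and $ s ( r ) = E ( r , b_2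 ) - c^{r + 1} $ for every integer $ r \geq 1 $; in particular $ s(n) $ can be written as the difference of two arithmetic terms.
   Context: $\mathbb{N}$ denotes the set of non-negative integers; sequences are indexed by $\mathbb{N}$. The generating function $\mathrm{GF}_t(z)$ of a sequence $t(n)$ is the formal power series $\sum_{i\ge 0} t(i) z^i$. The expression $\max(x-y,0)$ is the truncated subtraction. An arithmetic term in variables $n_1,\dots,n_r$ is an element of the inductive closure of $\mathbb{N}\cup\{n_1,\dots,n_r\}$ under $x+y$, $\max(x-y,0)$, $x\cdot y$, $\lfloor x/y\rfloor$, $x^y$, with conventions $0^0=1$ and $\lfloor x/0\rfloor=0$ (so $x \bmod 0 = x$, $x\bmod 1 = 0$). *)

(* Defs.v *)
From HB Require Import structures.
From mathcomp Require Import all_boot all_order all_algebra.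
From mathcomp Require Import all_classical all_reals all_analysis.

Set Implicit Arguments.
Unset Strict Implicit.
Unset Printing Implicit Defensive.

Import Order.TTheory GRing.Theory Num.Theory.
Import numFieldNormedType.Exports.

Local Open Scope classical_set_scope.
Local Open Scope ring_scope.

Inductive aterm (r : nat) : Type :=
  | AVar of 'I_r
  | ANat of nat
  | AAdd of aterm r & aterm r
  | ASub of aterm r & aterm r
  | AMul of aterm r & aterm r
  | ADiv of aterm r & aterm r
  | AExp of aterm r & aterm r.

(* subn truncates, x %/ 0 = 0 and 0 ^ 0 = 1 in nat, as required for terms. *)
Fixpoint aeval (r : nat) (v : 'I_r -> nat) (e : aterm r) : nat :=
  match e with
  | AVar i => v i
  | ANat k => k
  | AAdd e1 e2 => (aeval v e1 + aeval v e2)%N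
  | ASub e1 e2 => (aeval v e1 - aeval v e2)%N
  | AMul e1 e2 => (aeval v e1 * aeval v e2)%N
  | ADiv e1 e2 => (aeval v e1 %/ aeval v e2)%N
  | AExp e1 e2 => (aeval v e1 ^ aeval v e2)%N
  end.

(* Formal power series over Q are represented by their coefficient sequences,
   with the Cauchy product. *)
Definition fps : Type := nat -> rat.

Definition fps_mul (f g : fps) : fps :=
  fun n => \sum_(i < n.+1) f i * g (n - i)%N.

Definition fps_of_poly (p : {poly rat}) : fps := fun n => p`_n.

Definition GF (t : nat -> int) : fps := fun n => (t n)%:~R.

(* f = A / B, an equality in the field of Laurent series Q((z)), which contains
   both Q[[z]] and Q(z). *)
Definition fps_is_fraction (f : fps) (A B : {poly rat}) : Prop :=
  B != 0 /\ fps_mul (fps_of_poly B) f = fps_of_poly A.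

Definition fps_rational (f : fps) : Prop :=
  exists A B : {poly rat}, fps_is_fraction f A B.

(* For real coefficients, real points of convergence give the same supremum as
   complex ones. *)
Definition cvg_radius (R : realType) (a : nat -> R) : \bar R :=
  ereal_sup [set `|z|%:E | z in [set z : R | cvgn (pseries a z)]].

Definition polyQ (p : {poly nat}) : {poly rat} :=
  map_poly (fun k : nat => k%:R) p.

Definition irreducible_writing (f : fps) (Ap Am Bp Bm : {poly nat}) : Prop :=
  [/\ fps_is_fraction f (polyQ Ap - polyQ Am) (polyQ Bp - polyQ Bm),
      coprimep (polyQ Ap - polyQ Am) (polyQ Bp - polyQ Bm)
    & (Bm.[0] < Bp.[0])%N].

(* Computed in rat, since the degrees of Ap, Am, Bp, Bm may exceed those of the
   differences. The total division x / 0 = 0 agrees with floor (x / 0) = 0. *)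
Definition E (Ap Am Bp Bm : {poly nat}) (n b : nat) : int :=
  let h := (size (polyQ Bp - polyQ Bm)).-1 in
  let x : rat := b%:R ^- n in
  let N := Num.max (b%:R ^+ (n ^ 2 + h * n) * (polyQ Ap).[x]
                    - b%:R ^+ (n ^ 2 + h * n) * (polyQ Am).[x]) 0 in
  let D := Num.max (b%:R ^+ (h * n) * (polyQ Bp).[x]
                    - b%:R ^+ (h * n) * (polyQ Bm).[x]) 0 in
  (Num.floor (N / D) %% (b ^ n)%N%:Z)%Z.

(* Main.v *)
Require Import Defs.
From HB Require Import structures.
From mathcomp Require Import all_boot all_order all_algebra.
From mathcomp Require Import all_classical all_reals all_analysis.
From mathcomp Require Import zify ring lra.

Import Order.TTheory GRing.Theory Num.Theory.
Import numFieldNormedType.Exports.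

Local Open Scope ring_scope.

(** Choose c with |s(n)| < c^(n+1), so that 0 < t(n) < 2 c^(n+1), and take
    b = b_1 = b_2 = 8 c^6 and m = 3. If B is the characteristic denominator of
    the recurrence, then (1 - c z) B(z) GF_t(z) is a polynomial. In the reduced
    fraction A/B the denominator has no zero on [0, 1/(2c)], because there the
    series converges and A = B GF_t; hence B(b^-r) > 0. Finally
    b^(r^2) GF_t(b^-r) = sum_i t(i) b^(r(r-i)): the terms i <= r form an
    integer whose last base-b^r digit is t(r), and the terms i = r + k, k >= 1,
    are at most 2 * 8^-k, so they add up to less than 1 and the floor removes
    them. *)

(** * Products of a polynomial and a power series *)

(** A coefficient of a product sees only finitely many terms of [f], so truncating [f] reduces
    identities of series to identities in [{poly rat}]. *)
Lemma fps_mul_coefE (B : {poly rat}) (f : fps) (N n : nat) : (n < N)%N ->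
  fps_mul (fps_of_poly B) f n = (B * \poly_(i < N) f i)`_n.
Proof.
move=> ltnN; rewrite coefM; apply: eq_bigr => i _.
by rewrite coef_poly (leq_ltn_trans (leq_subr _ _) ltnN).
Qed.

Lemma fps_mul_polyM (B C : {poly rat}) (f : fps) :
  fps_mul (fps_of_poly (B * C)) f =
  fps_mul (fps_of_poly B) (fps_mul (fps_of_poly C) f).
Proof.
apply/funext => n; rewrite (fps_mul_coefE _ _ _ _ (ltnSn n)) -mulrA coefM.
apply: eq_bigr => i _; rewrite -fps_mul_coefE //.
by rewrite ltnS leq_subr.
Qed.

Lemma fps_of_polyM (B C : {poly rat}) :
  fps_of_poly (B * C) = fps_mul (fps_of_poly B) (fps_of_poly C).
Proof. by apply/funext => n; rewrite /fps_of_poly coefM. Qed.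

(** The coefficient of index n of the product is [g_0 f_n] plus earlier coefficients of [f], so [f]
    is determined recursively. *)
Lemma fps_mul_poly_inj (g : {poly rat}) (f1 f2 : fps) : g`_0 != 0 ->
  fps_mul (fps_of_poly g) f1 = fps_mul (fps_of_poly g) f2 -> f1 = f2.
Proof.
move=> g0 eqgf; apply/funext => n.
elim/ltn_ind: n => n IHn; have /(congr1 (fun h => h n)) := eqgf.
rewrite /fps_mul !big_ord_recl /= !subn0.
rewrite [X in _ + X = _](eq_bigr (fun i : 'I_n =>
  fps_of_poly g (bump 0 i) * f2 (n - bump 0 i)%N)).
  by move/addIr/(mulfI g0).
by move=> i _; rewrite IHn // /bump leq0n ltn_subrL /= (leq_trans _ (ltn_ord i)).
Qed.

(** * Existence of an irreducible writing *)

Lemma coef_polyQ (p : {poly nat}) (i : nat) : (polyQ p)`_i = (p`_i)%R%:R.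
Proof. by rewrite coef_map_id0. Qed.

Lemma int_poly_split (P : {poly int}) : exists Pp Pm : {poly nat},
  polyQ Pp - polyQ Pm = map_poly (intr : int -> rat) P.
Proof.
exists (\poly_(i < size P) if P`_i is Posz k then k else 0%N).
(* [Negz k] stands for -(k+1), whence [k.+1]. *)
exists (\poly_(i < size P) if P`_i is Negz k then k.+1 else 0%N).
apply/polyP => i; rewrite coefB !coef_polyQ !coef_poly.
case: ltnP => _; last by rewrite subr0.
by case: P`_i => k; rewrite ?subr0 // sub0r NegzE mulrNz.
Qed.

Lemma clear_denominators_pos (A B : {poly rat}) : B`_0 != 0 ->
  exists (PA PB : {poly int}) (k : rat),
    [/\ map_poly (intr : int -> rat) PA = k *: A,
        map_poly (intr : int -> rat) PB = k *: B & 0 < k * B`_0].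
Proof.
move=> B0.
have [qA [a a0 ->]] := rat_poly_scale A.
have [qB [b b0 defB]] := rat_poly_scale B.
have aR0 : a%:~R != 0 :> rat by rewrite intr_eq0.
have bR0 : b%:~R != 0 :> rat by rewrite intr_eq0.
(* The sign [e] makes the constant coefficient of the scaled denominator positive, as B_-(0) <
   B_+(0) demands. *)
pose e : int := if 0 < (a * b)%:~R * B`_0 then 1 else -1.
exists ((e * b) *: qA), ((e * a) *: qB), (e * a * b)%:~R; split.
- apply/polyP => i; rewrite coef_map_id0 // !coefZ coef_map_id0 // !rmorphM /=.
  by field.
- apply/polyP => i; rewrite defB coef_map_id0 // !coefZ coef_map_id0 //.
  by rewrite !rmorphM /=; field.
- rewrite -mulrA intrM -mulrA /e; have [h|h|h] := ltrgt0P ((a * b)%:~R * B`_0).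
  + by rewrite mulr1z mul1r.
  + by rewrite mulrN1z mulN1r oppr_gt0.
  + by move/eqP: h; rewrite mulf_eq0 (negPf B0) intr_eq0 mulf_eq0 (negPf a0) (negPf b0).
Qed.

Lemma irreducible_writing_exists (f : fps) (A B : {poly rat}) : B`_0 != 0 ->
  fps_mul (fps_of_poly B) f = fps_of_poly A ->
  exists Ap Am Bp Bm : {poly nat}, irreducible_writing f Ap Am Bp Bm.
Proof.
move=> B0 fE.
have Bn0 : B != 0 by apply: contraNneq B0 => ->; rewrite coef0.
pose g := gcdp A B.
have defA : A = g * (A %/ g) by rewrite mulrC divpK // dvdp_gcdl.
have defB : B = g * (B %/ g) by rewrite mulrC divpK // dvdp_gcdr.
have cop : coprimep (A %/ g) (B %/ g) by apply: coprimep_div_gcd; rewrite Bn0 orbT.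
(* Since [B_0] is the product of the two constant coefficients, neither vanishes; [g] can thus be
   cancelled from the series identity. *)
have /andP[g0 B1] : (g`_0 != 0) && ((B %/ g)`_0 != 0).
  by move: B0; rewrite {1}defB coef0M mulf_eq0 negb_or.
have {fE} fE : fps_mul (fps_of_poly (B %/ g)) f = fps_of_poly (A %/ g).
  apply: (fps_mul_poly_inj g) => //.
  by rewrite -fps_mul_polyM -fps_of_polyM -defB fE -defA.
have [PA [PB [k [PAE PBE kB]]]] := clear_denominators_pos (A %/ g) _ B1.
have k0 : k != 0 by apply: contraTneq kB => ->; rewrite mul0r ltxx.
have [Ap [Am AE]] := int_poly_split PA.
have [Bp [Bm BE]] := int_poly_split PB.
exists Ap, Am, Bp, Bm.
rewrite /irreducible_writing /fps_is_fraction AE BE PAE PBE; split.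
- split; last by rewrite -!mul_polyC fps_mul_polyM fE -fps_of_polyM.
  by rewrite scaler_eq0 negb_or k0 /=; apply: contraNneq B1 => ->; rewrite coef0.
- by rewrite coprimepZl // coprimepZr.
- have : 0 < (polyQ Bp - polyQ Bm)`_0 by rewrite BE PBE coefZ.
  by rewrite coefB !coef_polyQ subr_gt0 ltr_nat !horner_coef0.
Qed.

(** * Rationality and growth *)

(** From index [d] on, multiplying by [C] kills the part [s] and leaves the geometric sequence
    [c^(n-d) k], which the factor [1 - c z] then kills. *)
Lemma recurrence_plus_geometric_rational (s : nat -> int) (d c : nat) (alpha : nat -> rat)
    (s_rec : forall n : nat,
      (s (n + d)%N)%:~R
        + \sum_(1 <= i < d.+1) alpha i * (s (n + d - i)%N)%:~R = 0) :
  exists A B : {poly rat}, B`_0 = 1 /\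
    fps_mul (fps_of_poly B) (GF (fun n => s n + (c ^ n.+1)%N%:Z)) = fps_of_poly A.
Proof.
pose t n : int := s n + (c ^ n.+1)%N%:Z.
pose C : {poly rat} := \poly_(i < d.+1) (if i == 0%N then 1 else alpha i).
pose B : {poly rat} := (1 - c%:R *: 'X) * C.
pose u := fps_mul (fps_of_poly C) (GF t).
pose k : rat := \sum_(0 <= i < d.+1) C`_i * c%:R ^+ (d - i).+1.
have uE n : (d <= n)%N -> u n = c%:R ^+ (n - d) * k.
  move=> ledn; rewrite /u /fps_mul -(big_mkord xpredT
    (fun i => C`_i * GF t (n - i)%N)).
  rewrite (@big_cat_nat _ _ _ d.+1) //=.
  rewrite [X in _ + X]big1_seq ?addr0; last first.
    move=> i; rewrite mem_index_iota => /= /andP[ltdi _].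
    by rewrite /C coef_poly ltnNge ltdi mul0r.
  rewrite (eq_big_nat _ _ (F2 := fun i =>
     C`_i * (s (n - i)%N)%:~R + c%:R ^+ (n - d) * (C`_i * c%:R ^+ (d - i).+1))).
    rewrite big_split /= -mulr_sumr -/k.
    suff -> : \sum_(0 <= i < d.+1) C`_i * (s (n - i)%N)%:~R = 0 by rewrite add0r.
    rewrite -[RHS](s_rec (n - d)%N) subnK // big_nat_recl // big_add1 /=.
    rewrite /C coef_poly /= mul1r subn0; congr (_ + _).
    by apply: eq_big_nat => i /= ltid; rewrite coef_poly /= ltnS ltid.
  move=> i /= ltid; rewrite /GF /t intrD mulrDr; congr (_ + _).
  rewrite mulrCA -exprD -natrX; congr (_ * _%:R); congr (_ ^ _)%N.
  by lia.
(* Index [d] is kept in [A]: the cancellation [u n - c u(n-1) = 0] needs both indices to be at least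
   [d]. *)
pose A : {poly rat} := \poly_(i < d.+1) fps_mul (fps_of_poly B) (GF t) i.
exists A, B; split.
  by rewrite coef0M coefB coef1 coefZ coefX mulr0 subr0 mul1r coef_poly.
apply/funext => n; rewrite {2}/fps_of_poly coef_poly; case: ltnP => // ltdn.
rewrite /B fps_mul_polyM -/u (fps_mul_coefE _ _ n.+1) //.
rewrite mulrBl mul1r coefB -scalerAl coefZ coefXM !coef_poly ltnSn.
case: n ltdn => [//|n] ledn /=; rewrite leqnSn !uE // 1?ltnW //.
by rewrite subSn // exprS mulrA subrr.
Qed.

Lemma recurrence_exponential_bound (s : nat -> int) (d : nat) (alpha : nat -> rat)
    (s_rec : forall n : nat,
      (s (n + d)%N)%:~R
        + \sum_(1 <= i < d.+1) alpha i * (s (n + d - i)%N)%:~R = 0) :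
  exists c : nat, (0 < c)%N /\ forall n, (`|s n| < c ^ n.+1)%N.
Proof.
pose S := \sum_(1 <= i < d.+1) `|alpha i|.
have S0 : 0 <= S by apply: sumr_ge0.
(* The first summand makes [c > S], for the induction step; the second exceeds every initial |s(k)|,
   for the base case. *)
pose c := (Num.bound S + (\sum_(k < d) `|s k|).+1)%N.
have ltSc : S < c%:R.
  by apply: lt_le_trans (archi_boundP S0) _; rewrite ler_nat leq_addr.
have c0 : (0 < c)%N by rewrite /c addnS.
exists c; split => //; elim/ltn_ind => n IHn.
have [ltnd|ledn] := ltnP n d.
  apply: (@leq_trans c); last by rewrite -{1}(expn1 c) leq_pexp2l.
  rewrite /c addnS ltnS (leq_trans _ (leq_addl _ _)) //.
  by rewrite (bigD1 (Ordinal ltnd)) //= leq_addr.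
rewrite -(ltr_nat rat) natr_absz intr_norm.
have /eqP := s_rec (n - d)%N; rewrite subnK // addr_eq0 => /eqP ->.
rewrite normrN (le_lt_trans (ler_norm_sum _ _ _)) //.
(* By induction each |s(n-i)| with i >= 1 is at most [c^n], so |s(n)| <= [S c^n] < [c^(n+1)]. *)
apply: (@le_lt_trans _ _ (S * (c ^ n)%N%:R)); last first.
  by rewrite expnS natrM ltr_pM2r // ltr0n expn_gt0 c0.
rewrite /S mulr_suml big_seq [leRHS]big_seq; apply: ler_sum => i.
rewrite mem_index_iota => /andP[i0 ltid].
rewrite normrM ler_wpM2l // -intr_norm -natr_absz ler_nat ltnW //.
have lein : (i <= n)%N by rewrite (leq_trans _ ledn).
apply: (leq_trans (IHn _ _)); first by rewrite ltn_subrL i0 (leq_trans i0).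
by rewrite leq_pexp2l // ltn_subrL i0 (leq_trans i0).
Qed.

(** * Evaluating the fraction at real points *)

(** Both sides sum over the triangle i + l < N, by antidiagonals and by rows; the rows exhibit
    partial sums of [f]. *)
Lemma cauchy_product_partial_sum (F : comPzRingType) (a f : nat -> F) (x : F) (N : nat) :
  \sum_(k < N) (\sum_(i < k.+1) a i * f (k - i)%N) * x ^+ k =
  \sum_(i < N) a i * x ^+ i * \sum_(0 <= l < N - i) f l * x ^+ l.
Proof.
elim: N => [|N IHN]; first by rewrite !big_ord0.
rewrite big_ord_recr /= IHN [RHS]big_ord_recr /= subSnn big_nat1.
rewrite expr0 mulr1 [X in _ = X + _](eq_bigr (fun i : 'I_N =>
  a i * x ^+ i * (\sum_(0 <= l < N - i) f l * x ^+ l)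
  + a i * f (N - i)%N * x ^+ N)).
  rewrite big_split /= -addrA; congr (_ + _).
  rewrite big_ord_recr /= subnn mulrDl mulr_suml; congr (_ + _).
  by rewrite mulrAC.
move=> i _; have ltiN := ltn_ord i.
rewrite subSn 1?ltnW // big_nat_recr //= mulrDr; congr (_ + _).
rewrite mulrACA -exprD subnKC // ltnW //.
Qed.

(** As [B] is a polynomial, a late partial sum of [B f] is a fixed finite combination of shifted
    partial sums of [f], so plain convergence suffices for the limit. Those partial sums are
    eventually constant, equal to [A(x)]. *)
Lemma fraction_eval (R : realType) (A B : {poly rat}) (f : fps) (x : R) :
  fps_mul (fps_of_poly B) f = fps_of_poly A ->
  cvgn (pseries (fun n => ratr (f n) : R) x) ->
  (map_poly ratr B).[x] * limn (pseries (fun n => ratr (f n) : R) x) =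
  (map_poly ratr A).[x].
Proof.
move=> fE fcvg; set P := pseries _ x; set L := limn P.
pose G (i N : nat) : R := ratr B`_i * x ^+ i * P (N - i)%N.
have Gcvg : ((\sum_(i < size B) G i N) @[N --> \oo] -->
              \sum_(i < size B) ratr B`_i * x ^+ i * L)%classic.
  apply: cvg_big; first exact: add_continuous.
  move=> i _; apply: cvgMr.
  by rewrite cvg_centern.
have : ((\sum_(i < size B) G i N) @[N --> \oo] --> (map_poly ratr A).[x])%classic.
  apply: cvg_near_cst; exists (size A + size B)%N => // N /= leN.
  have leAN : (size A <= N)%N by apply: leq_trans leN; apply: leq_addr.
  have leBN : (size B <= N)%N by apply: leq_trans leN; apply: leq_addl.
  rewrite (@horner_coef_wide _ N) ?size_map_poly //.
  transitivity (\sum_(i < N) G i N).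
    rewrite -[RHS](big_mkord xpredT (fun i => G i N)) (big_cat_nat _ leBN) //=.
    rewrite big_mkord [X in _ + X]big1_seq ?addr0 // => i.
    rewrite mem_index_iota => /= /andP[lei _].
    by rewrite /G nth_default // rmorph0 !mul0r.
  rewrite /G /P /pseries /series /=.
  rewrite -(cauchy_product_partial_sum _ (fun i => ratr B`_i) (fun i => ratr (f i))).
  apply: eq_bigr => k _; congr (_ * _); rewrite coef_map /=.
  have -> : A`_k = fps_mul (fps_of_poly B) f k by rewrite fE.
  by rewrite rmorph_sum; apply: eq_bigr => i _; rewrite rmorphM.
move=> /(cvg_unique _ Gcvg) <- //.
rewrite -mulr_suml; congr (_ * _).
rewrite (@horner_coef_wide _ (size B)) ?size_map_poly //.
by apply: eq_bigr => i _; rewrite coef_map.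
Qed.

Lemma pseries_exp_cvg (R : realType) (u : nat -> nat) (c : nat) (x : R) :
  (forall n, u n <= 2 * c ^ n.+1)%N -> 0 <= x -> 2 * c%:R * x <= 1 ->
  cvgn (pseries (fun n => (u n)%:R) x).
Proof.
move=> uc x0 cx.
have cx2 : c%:R * x <= 2^-1 by rewrite -(ler_pM2l (ltr0n R 2)) mulrA divff.
(* Since c x <= 1/2, the terms are dominated by [2c 2^-n]. *)
apply: (@series_le_cvg _ _ (geometric (2 * c)%:R 2^-1)).
- by move=> n /=; rewrite mulr_ge0 ?exprn_ge0.
- by move=> n /=; rewrite mulr_ge0 ?exprn_ge0.
- move=> n /=; apply: (@le_trans _ _ ((2 * c ^ n.+1)%N%:R * x ^+ n)).
    by rewrite ler_wpM2r ?exprn_ge0 // ler_nat.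
  rewrite expnS mulnA natrM -mulrA ler_wpM2l // natrX -exprMn.
  by rewrite lerXn2r ?nnegrE ?mulr_ge0 ?invr_ge0.
- by apply: is_cvg_geometric_series; rewrite ger0_norm // invf_lt1 // ltr1n.
Qed.

(* A zero of B inside the disc of convergence would be a zero of A = B f too. *)
Lemma denominator_gt0 (R : realType) (u : nat -> nat) (c : nat)
    (A B : {poly rat}) (x : R) :
  (forall n, u n <= 2 * c ^ n.+1)%N ->
  fps_mul (fps_of_poly B) (fun n => (u n)%:R) = fps_of_poly A ->
  coprimep A B -> 0 < B`_0 -> 0 <= x -> 2 * c%:R * x <= 1 ->
  0 < (map_poly ratr B : {poly R}).[x].
Proof.
move=> uc fE cop B0 x0 cx; rewrite ltNge; apply/negP => Bx.
have [|y /andP[y0 yx] By] := @poly_ivt R (- map_poly ratr B) 0 x x0.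
  by rewrite !hornerN oppr_ge0 Bx oppr_le0 horner_coef0 coef_map /= ler0q ltW.
rewrite rootN in By.
have cy : 2 * c%:R * y <= 1 by apply: le_trans cx; rewrite ler_wpM2l.
have ycvg := @pseries_exp_cvg R u c y uc y0 cy.
have uE : (fun n => ratr ((u n)%:R : rat)) = (fun n => (u n)%:R : R).
  by apply/funext => n; rewrite ratr_nat.
have := @fraction_eval R _ _ _ y fE; rewrite uE => /(_ ycvg).
rewrite (rootP By) mul0r => /esym/eqP Ay.
have : coprimep (map_poly ratr A : {poly R}) (map_poly ratr B) by rewrite coprimep_map.
by move/coprimep_root => /(_ y Ay); rewrite (rootP By) eqxx.
Qed.

(** * Extracting the digit *)

(** In [(8 c^6)^(r k)] the power of 8 absorbs [8^k], and the power of [c] absorbs [c^(r+k+1)],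
    because r + k + 1 <= 3 r k for r, k >= 1. *)
Lemma exp_tail_bound (u : nat -> nat) (c r k : nat) : (0 < c)%N ->
  (forall n, u n <= 2 * c ^ n.+1)%N -> (0 < r)%N -> (0 < k)%N ->
  (u (r + k) * 8 ^ k <= 2 * (8 * c ^ 6) ^ (r * k))%N.
Proof.
move=> c0 uc r0 k0; apply: (@leq_trans (2 * c ^ (r + k).+1 * 8 ^ k)).
  by rewrite leq_mul2r uc orbT.
rewrite -mulnA leq_mul2l /= expnMn mulnC -expnM leq_mul // leq_pexp2l //; nia.
Qed.

(** For i < r the exponent r (r - i) is at least r, so only the term i = r survives modulo [b^r]. *)
Lemma base_digit (u : nat -> nat) (b r : nat) : (0 < r)%N -> (u r < b ^ r)%N ->
  ((\sum_(i < r.+1) u i * b ^ (r * (r - i))) %% b ^ r = u r)%N.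
Proof.
move=> r0 ltu; rewrite big_ord_recr /= subnn muln0 muln1.
rewrite (eq_bigr (fun i : 'I_r => u i * b ^ (r * (r - i.+1)) * b ^ r)%N).
  by rewrite -big_distrl /= modnMDl modn_small.
move=> i _; have lti := ltn_ord i.
by rewrite -mulnA -expnD addnC -mulnS subnSK.
Qed.

Lemma exprDVn (F : fieldType) (b : F) (m n : nat) : b != 0 ->
  b ^+ (m + n) * b ^- m = b ^+ n.
Proof. by move=> b0; rewrite exprD mulrAC divff ?mul1r // expf_neq0. Qed.

Lemma pseries_integral_part (R : realType) (u : nat -> nat) (c r : nat)
    (b := (8 * c ^ 6)%N) (x := b%:R ^- r : R)
    (Q := (\sum_(i < r.+1) u i * b ^ (r * (r - i)))%N)
    (L := limn (pseries (fun n => (u n)%:R) x)) : (0 < c)%N ->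
  (forall n, u n <= 2 * c ^ n.+1)%N -> (0 < r)%N ->
  cvgn (pseries (fun n => (u n)%:R) x) ->
  Q%:R <= b%:R ^+ (r ^ 2) * L < Q.+1%:R.
Proof.
move=> c0 uc r0 xcvg.
have b0 : (0 < b)%N by rewrite /b muln_gt0 expn_gt0 c0.
have bR0 : b%:R != 0 :> R by rewrite pnatr_eq0 -lt0n.
have x0 : 0 <= x by rewrite invr_ge0 exprn_ge0.
have xX i : x ^+ i = b%:R ^- (r * i) by rewrite exprVn -exprM.
have bX0 : 0 < b%:R ^+ (r ^ 2) :> R by rewrite exprn_gt0 // ltr0n.
set P := pseries _ x in xcvg L *.
have PS n : P n.+1 = P n + (u n)%:R * x ^+ n by rewrite /P /pseries /series /= big_nat_recr.
(* [P n] sums the indices below n, so [P r.+1] is the part i <= r. *)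
have QE : Q%:R = b%:R ^+ (r ^ 2) * P r.+1.
  rewrite /Q /P /pseries /series /= big_mkord natr_sum mulr_sumr.
  apply: eq_bigr => i _; have := ltn_ord i; rewrite ltnS => leir.
  rewrite natrM mulrCA xX; congr (_ * _); rewrite natrX.
  by rewrite -[LHS](exprDVn _ _ (r * i)) // -mulnDr subnKC // mulnn.
have Pmono : {homo P : n m / (n <= m)%N >-> n <= m}.
  apply/nondecreasing_seqP => n.
  by rewrite PS lerDl mulr_ge0 // exprn_ge0.
(* 2/7 (1 - 8^-k) is the sum of 2 * 8^-j for j = 1, ..., k. *)
have Ptail k : b%:R ^+ (r ^ 2) * P (r.+1 + k)%N <= Q%:R + 2 / 7 * (1 - 8^-1 ^+ k).
  elim: k => [|k IHk]; first by rewrite addn0 QE expr0 subrr mulr0 addr0.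
  rewrite addnS PS mulrDr; apply: (le_trans (lerD IHk (lexx _))).
  rewrite -addrA lerD2l addSnnS.
  have : (u (r + k.+1)%N)%:R * (b%:R ^+ (r ^ 2) * x ^+ (r + k.+1)) <= 2 * 8^-1 ^+ k.+1 :> R.
    rewrite xX mulnDr mulnn.
    have -> : b%:R ^+ (r ^ 2) * b%:R ^- (r ^ 2 + r * k.+1) = b%:R ^- (r * k.+1) :> R.
      by rewrite exprD invfM mulrA divff ?mul1r // expf_neq0.
    rewrite exprVn ler_pdivrMr; last by rewrite exprn_gt0 // ltr0n.
    rewrite mulrAC ler_pdivlMr ?exprn_gt0 // -!natrX -!natrM ler_nat.
    exact: exp_tail_bound.
  rewrite mulrCA exprS.
  have : 0 <= 8^-1 ^+ k :> R by rewrite exprn_ge0.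
  set e := 8^-1 ^+ k; lra.
apply/andP; split.
  by rewrite QE ler_pM2l // /L nondecreasing_cvgn_le.
(* The uniform bound 2/7 on the tail keeps the inequality strict in the limit. *)
suff : L <= (Q%:R + 2 / 7) / b%:R ^+ (r ^ 2).
  rewrite ler_pdivlMr // mulrC => /le_lt_trans; apply.
  by rewrite -[ltRHS]natr1 ltrD2l; lra.
apply: limr_le => //; exists r.+1 => // n /= ltrn.
rewrite ler_pdivlMr // mulrC -(subnKC ltrn); apply: (le_trans (Ptail _)).
rewrite lerD2l ler_piMr // lerBlDr lerDl exprn_ge0 //.
Qed.

(** Multiplying the bounds on the series by [B(x) > 0] replaces the real limit by [A(x)]; the
    inequalities then involve only rationals and descend along [ratr]. *)
Lemma digit_extraction (R : realType) (u : nat -> nat) (c r : nat)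
    (A B : {poly rat}) (b := (8 * c ^ 6)%N) (x := b%:R ^- r : rat) :
  (0 < c)%N -> (forall n, u n < 2 * c ^ n.+1)%N ->
  fps_mul (fps_of_poly B) (fun n => (u n)%:R) = fps_of_poly A ->
  coprimep A B -> 0 < B`_0 -> (0 < r)%N ->
  exists Q : nat, [/\ (Q %% b ^ r = u r)%N, 0 < B.[x]
    & Q%:R * B.[x] <= b%:R ^+ (r ^ 2) * A.[x] < Q.+1%:R * B.[x]].
Proof.
move=> c0 uc fE cop B0 r0.
have uc' n : (u n <= 2 * c ^ n.+1)%N by rewrite ltnW.
have b0 : (0 < b)%N by rewrite /b muln_gt0 expn_gt0 c0.
have xR : ratr x = b%:R ^- r :> R by rewrite /x fmorphV rmorphXn /= ratr_nat.
have x0 : 0 <= ratr x :> R by rewrite xR invr_ge0 exprn_ge0.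
have cx : 2 * c%:R * ratr x <= 1 :> R.
  rewrite xR ler_pdivrMr ?mul1r ?exprn_gt0 ?ltr0n // -natrX -natrM ler_nat.
  apply: (@leq_trans (b ^ 1)); last by rewrite leq_pexp2l.
  by rewrite expn1 /b leq_mul // -{1}(expn1 c) leq_pexp2l.
have xcvg := @pseries_exp_cvg R u c _ uc' x0 cx.
have BR := @denominator_gt0 R u c A B _ uc' fE cop B0 x0 cx.
have hE (p : {poly rat}) : (map_poly ratr p).[ratr x] = ratr p.[x] :> R by rewrite horner_map.
have uE : (fun n => ratr ((u n)%:R : rat)) = (fun n => (u n)%:R : R).
  by apply/funext => n; rewrite ratr_nat.
have AE := @fraction_eval R _ _ _ (ratr x) fE; rewrite uE in AE.
have {}AE := AE xcvg; rewrite xR in xcvg AE.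
have := pseries_integral_part R u c r c0 uc' r0 xcvg; rewrite -/b.
set Q := (\sum_(i < _) _)%N => /andP[QL LQ].
exists Q; split.
- apply: base_digit => //; apply: (leq_trans (uc r)).
  rewrite /b expnMn -expnM leq_mul //; first by rewrite (@leq_trans (8 ^ 1)) // leq_pexp2l.
  by rewrite leq_pexp2l //; lia.
- by move: BR; rewrite hE ltr0q.
- rewrite -(ler_rat R) -(ltr_rat R) !rmorphM /= rmorphXn /= !ratr_nat -!hE.
  rewrite xR in BR *; rewrite -AE mulrCA [X in _ <= X]mulrC [X in X < _]mulrC.
  by rewrite ler_pM2r // ltr_pM2r // QL LQ.
Qed.

(** Here [B(x) > 0] and, by the lower bound, [A(x) >= 0], so neither [max] truncates; the common
    factor [b^(h r)] cancels and the floor is [Q]. *)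
Lemma E_digit (Ap Am Bp Bm : {poly nat}) (b r Q : nat)
    (A := polyQ Ap - polyQ Am) (B := polyQ Bp - polyQ Bm) (x := b%:R ^- r : rat) :
  (0 < b)%N -> 0 < B.[x] ->
  Q%:R * B.[x] <= b%:R ^+ (r ^ 2) * A.[x] < Q.+1%:R * B.[x] ->
  E Ap Am Bp Bm r b = (Q %% b ^ r)%N%:Z.
Proof.
move=> b0 Bx /andP[lbA ubA].
have bX0 n : 0 < b%:R ^+ n :> rat by rewrite exprn_gt0 // ltr0n.
have Ax : 0 <= A.[x].
  by rewrite -(pmulr_rge0 _ (bX0 (r ^ 2)%N)) (le_trans _ lbA) // mulr_ge0 // ltW.
rewrite /E -/B -/x -!mulrBr.
have -> : (polyQ Ap).[x] - (polyQ Am).[x] = A.[x] by rewrite hornerD hornerN.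
have -> : (polyQ Bp).[x] - (polyQ Bm).[x] = B.[x] by rewrite hornerD hornerN.
rewrite !max_l ?mulr_ge0 ?(ltW Bx) ?(ltW (bX0 _)) // exprD.
set h := (_ * r)%N.
have -> : b%:R ^+ (r ^ 2) * b%:R ^+ h * A.[x] / (b%:R ^+ h * B.[x]) =
          b%:R ^+ (r ^ 2) * A.[x] / B.[x].
  rewrite [X in X / _]mulrAC [X in X / _]mulrC -[LHS]mulf_div divff ?mul1r //.
  by rewrite gt_eqF.
rewrite (@floor_def _ _ Q%:Z) ?modz_nat //.
rewrite ler_pdivlMr // lbA /= ltr_pdivrMr //.
by rewrite intrD -[Q%:~R]/(Q%:R) natr1.
Qed.

(** * Arithmetic terms *)

(** A term for [b^(e + H n) p(b^-n)]: when [H] is at least the size of [p], the factor [b^(H n)]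
    clears all negative exponents. *)
Definition poly_aterm (p : {poly nat}) (H b : nat) (e : aterm 1) : aterm 1 :=
  foldr (@AAdd 1) (ANat 1 0)
    [seq AMul (ANat 1 (p`_i)%R) (AExp (ANat 1 b)
           (AAdd e (AMul (ANat 1 (H - i)) (AVar ord0)))) | i <- iota 0 H].

Lemma aeval_foldr_add (r : nat) (v : 'I_r -> nat) (I : Type) (l : seq I) (F : I -> aterm r) :
  aeval v (foldr (@AAdd r) (ANat r 0) [seq F i | i <- l]) = (\sum_(i <- l) aeval v (F i))%N.
Proof. by elim: l => [|i l IHl] /=; rewrite ?big_nil ?big_cons ?IHl. Qed.

Lemma aeval_poly_aterm (p : {poly nat}) (H b n : nat) (e : aterm 1) :
  (size p <= H)%N -> (0 < b)%N ->
  (aeval (fun=> n) (poly_aterm p H b e))%:R =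
  b%:R ^+ (aeval (fun=> n) e + H * n) * (polyQ p).[b%:R ^- n] :> rat.
Proof.
move=> leH b0; have bR0 : b%:R != 0 :> rat by rewrite pnatr_eq0 -lt0n.
rewrite aeval_foldr_add -[H in iota 0 H]subn0 big_mkord.
rewrite (@horner_coef_wide _ H); last by rewrite (leq_trans (size_poly _ _)).
rewrite natr_sum mulr_sumr; apply: eq_bigr => i _.
rewrite /= natrM coef_polyQ mulrCA; congr (_ * _); rewrite natrX.
rewrite exprVn -exprM -[LHS](exprDVn _ _ (n * i)) //; congr (_ ^+ _ * _).
by rewrite addnCA mulnC -mulnDl subnKC // ltnW.
Qed.

Lemma aeval_poly_aterm_sub (p q : {poly nat}) (H b n : nat) (e : aterm 1) :
  (size p <= H)%N -> (size q <= H)%N -> (0 < b)%N ->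
  0 <= (polyQ p - polyQ q).[b%:R ^- n] ->
  (aeval (fun=> n) (ASub (poly_aterm p H b e) (poly_aterm q H b e)))%:R =
  b%:R ^+ (aeval (fun=> n) e + H * n) * (polyQ p - polyQ q).[b%:R ^- n] :> rat.
Proof.
move=> pH qH b0 pq0.
rewrite hornerD hornerN mulrBr -!aeval_poly_aterm // natrB //.
rewrite -(ler_nat rat) !aeval_poly_aterm // ler_pM2l ?exprn_gt0 ?ltr0n //.
by rewrite -subr_ge0 -hornerN -hornerD.
Qed.

Lemma digit_aterm (Ap Am Bp Bm : {poly nat}) (b : nat) (u : nat -> nat)
    (A := polyQ Ap - polyQ Am) (B := polyQ Bp - polyQ Bm) :
  (0 < b)%N ->
  (forall r, (0 < r)%N -> exists Q : nat,
    [/\ (Q %% b ^ r = u r)%N, 0 < B.[b%:R ^- r]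
      & Q%:R * B.[b%:R ^- r] <= b%:R ^+ (r ^ 2) * A.[b%:R ^- r]
          < Q.+1%:R * B.[b%:R ^- r]]) ->
  exists T : aterm 1, forall n, aeval (fun=> n) T = u n.
Proof.
move=> b0 digit; pose n1 : aterm 1 := AVar ord0.
(* Leading coefficients may cancel in the differences, so the degree h of [E] could leave negative
   exponents in the single parts. [H] bounds all four sizes, and its extra power of [b] cancels in
   the quotient. *)
pose H := (size Ap + size Am + size Bp + size Bm)%N.
pose e1 := AMul n1 n1; pose e2 := ANat 1 0.
pose N := ASub (poly_aterm Ap H b e1) (poly_aterm Am H b e1).
pose D := ASub (poly_aterm Bp H b e2) (poly_aterm Bm H b e2).
pose bn := AExp (ANat 1 b) n1; pose q := ADiv N D.
(* The modulus b ^ n is 1 at n = 0, so the first summand vanishes there; the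
   second one, supported at 0 by truncation, supplies that value. *)
exists (AAdd (ASub q (AMul (ADiv q bn) bn))
             (AMul (ANat 1 (u 0%N)) (ASub (ANat 1 1) n1))).
case=> [|n]; first by rewrite /= expn0 divn1 !muln1 subnn add0n.
have [Q [Qmod Bx /andP[lbA ubA]]] := digit n.+1 isT.
have bX0 k : 0 < b%:R ^+ k :> rat by rewrite exprn_gt0 // ltr0n.
have Ax : 0 <= A.[b%:R ^- n.+1].
  by rewrite -(pmulr_rge0 _ (bX0 (n.+1 ^ 2)%N)) (le_trans _ lbA) // mulr_ge0 // ltW.
have NE : (aeval (fun=> n.+1) N)%:R =
    b%:R ^+ (n.+1 ^ 2 + H * n.+1) * A.[b%:R ^- n.+1] :> rat.
  by rewrite aeval_poly_aterm_sub ?mulnn // /H; lia.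
have DE : (aeval (fun=> n.+1) D)%:R = b%:R ^+ (H * n.+1) * B.[b%:R ^- n.+1] :> rat.
  by rewrite aeval_poly_aterm_sub ?(ltW Bx) // /H; lia.
have D0 : (0 < aeval (fun=> n.+1) D)%N by rewrite -(ltr0n rat) DE mulr_gt0.
have qE : aeval (fun=> n.+1) q = Q.
  rewrite [LHS]/=; apply/eqP; rewrite eqn_leq -ltnS ltn_divLR // leq_divRL //.
  rewrite -(ltr_nat rat) -(ler_nat rat) !natrM NE DE addnC exprD -mulrA.
  by rewrite !(mulrCA _ (b%:R ^+ (H * _))) ler_pM2l // ltr_pM2l // lbA ubA.
(* Remainder is not a constructor of [aterm]; it is spelled [m - m %/ k * k]. *)
rewrite -Qmod -qE; have modE m k : (m %% k = m - m %/ k * k)%N.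
  by rewrite [X in (X - _)%N](divn_eq m k) addKn.
by rewrite modE [LHS]/= muln0 addn0.
Qed.

(** * Radius, cube-root bound and conclusion *)

Lemma exp_lt_powR_third (R : realType) (u b n : nat) : (u ^ 3 < b ^ n)%N ->
  u%:R < (b%:R : R) `^ (n%:R / 3).
Proof.
move=> ltub; rewrite powRrM powR_mulrn //.
have -> : u%:R = (u%:R ^+ 3) `^ 3^-1 :> R.
  by rewrite -powR_mulrn // -powRrM divff ?powRr1.
by apply: gt0_ltr_powR; rewrite ?invr_gt0 // ?nnegrE ?exprn_ge0 // -!natrX ltr_nat.
Qed.

(** The point 1/(2c) is itself a point of convergence, hence a lower bound for the radius. *)
Lemma cvg_radius_exp (R : realType) (u : nat -> nat) (c : nat) (y : R) :
  (0 < c)%N -> (forall n, u n <= 2 * c ^ n.+1)%N -> y < (2 * c)%N%:R^-1 ->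
  (y%:E < cvg_radius (fun n => (u n)%:R : R))%E.
Proof.
move=> c0 uc ylt; pose z : R := (2 * c)%N%:R^-1.
have z0 : 0 <= z by rewrite invr_ge0.
apply: (@lt_le_trans _ _ z%:E); first by rewrite lte_fin.
apply: ereal_sup_ubound; exists z => /=; last by rewrite ger0_norm.
apply: (@pseries_exp_cvg R u c) => //.
by rewrite -natrM divff // pnatr_eq0 muln_eq0 -lt0n.
Qed.

Theorem theorem5p10 (R : realType) (s : nat -> int) (d : nat)
    (alpha : nat -> rat)
    (s_neq0 : exists n : nat, s n <> 0)
    (d_gt0 : (0 < d)%N)
    (alpha_d_neq0 : alpha d <> 0)
    (s_rec : forall n : nat,
      (s (n + d)%N)%:~R
        + \sum_(1 <= i < d.+1) alpha i * (s (n + d - i)%N)%:~R = 0) :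
  (exists b1 b2 c m : nat,
    [/\ (2 <= b1)%N, (8 <= b2)%N, (0 <= c)%N & (3 <= m)%N] /\
    let t := fun n : nat => s n + (c ^ n.+1)%N%:Z in
    let rho := cvg_radius (fun n : nat => (t n)%:~R : R) in
    [/\ forall n : nat, 0 <= t n,
        exists n : nat, 0 < t n
      & fps_rational (GF t)] /\
    [/\ ((b1%:R ^- m)%:E < rho)%E,
        forall n : nat, (m <= n)%N -> t n < (b1 ^ (n - 2))%N%:Z,
        ((b2%:R^-1)%:E < rho)%E
      & forall n : nat, (1 <= n)%N ->
          (t n)%:~R < (b2%:R : R) `^ (n%:R / 3)] /\
    (exists Ap Am Bp Bm : {poly nat}, irreducible_writing (GF t) Ap Am Bp Bm) /\
    (forall Ap Am Bp Bm : {poly nat}, irreducible_writing (GF t) Ap Am Bp Bm ->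
      (forall r : nat, (m <= r)%N ->
         s r = E Ap Am Bp Bm r b1 - (c ^ r.+1)%N%:Z) /\
      (forall r : nat, (1 <= r)%N ->
         s r = E Ap Am Bp Bm r b2 - (c ^ r.+1)%N%:Z))) /\
  (exists T1 T2 : aterm 1, forall n : nat,
     s n = (aeval (fun=> n) T1)%:Z - (aeval (fun=> n) T2)%:Z).
Proof.
have [c [c0 sc]] := recurrence_exponential_bound s d alpha s_rec.
pose b := (8 * c ^ 6)%N.
pose t n : int := s n + (c ^ n.+1)%N%:Z.
pose u n := `|t n|%N.
(* The strict bound |s(n)| < [c^(n+1)] makes every t(n) positive, so [t] is a sequence [u] of
   naturals. *)
have tgt0 n : 0 < t n by move: (sc n); rewrite /t; lia.
have tE n : t n = (u n)%:Z by rewrite /u; move: (tgt0 n); lia.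
have uc n : (u n < 2 * c ^ n.+1)%N by move: (sc n); rewrite /u /t; lia.
have uc' n : (u n <= 2 * c ^ n.+1)%N by rewrite ltnW.
have b8 : (8 <= b)%N by apply: leq_pmulr; rewrite expn_gt0 c0.
have b0 : (0 < b)%N by rewrite (leq_trans _ b8).
have sE n (k : nat) : k = u n -> s n = k%:Z - (c ^ n.+1)%N%:Z.
  by move=> ->; rewrite -tE /t addrK.
have GFE : GF t = (fun n => (u n)%:R) by apply/funext => n; rewrite /GF tE.
have [A [B [B0 fE]]] := recurrence_plus_geometric_rational s d c alpha s_rec.
have Bn0 : B != 0 by apply: contra_eq_neq B0 => ->; rewrite coef0 eq_sym oner_eq0.
have iw_ex := irreducible_writing_exists (GF t) A B _ fE.
have {}iw_ex : exists Ap Am Bp Bm : {poly nat}, irreducible_writing (GF t) Ap Am Bp Bm.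
  by apply: iw_ex; rewrite B0 oner_eq0.
have digit Ap Am Bp Bm : irreducible_writing (GF t) Ap Am Bp Bm ->
    forall r, (0 < r)%N -> exists Q : nat,
    [/\ (Q %% b ^ r = u r)%N, 0 < (polyQ Bp - polyQ Bm).[b%:R ^- r]
      & Q%:R * (polyQ Bp - polyQ Bm).[b%:R ^- r]
          <= b%:R ^+ (r ^ 2) * (polyQ Ap - polyQ Am).[b%:R ^- r]
          < Q.+1%:R * (polyQ Bp - polyQ Bm).[b%:R ^- r]].
  case=> -[_ iwE] cop ltB r r0; rewrite GFE in iwE.
  apply: (@digit_extraction R u c r _ _ c0 uc iwE cop _ r0).
  by rewrite coefB !coef_polyQ subr_gt0 ltr_nat -!horner_coef0.
have sEE Ap Am Bp Bm : irreducible_writing (GF t) Ap Am Bp Bm ->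
    forall r, (0 < r)%N -> s r = E Ap Am Bp Bm r b - (c ^ r.+1)%N%:Z.
  move=> /digit iw r r0; have [Q [Qmod Bx QA]] := iw r r0.
  by rewrite (@E_digit _ _ _ _ b r Q) // Qmod; apply: sE.
have binv : b%:R^-1 < (2 * c)%N%:R^-1 :> R.
  rewrite ltf_pV2 ?posrE ?ltr0n // ?muln_gt0 // ltr_nat /b.
  apply: (@leq_trans (8 * c)); first by rewrite ltn_pmul2r.
  by rewrite leq_mul2l /= -{1}(expn1 c) leq_pexp2l.
have rhoE : (fun n => (t n)%:~R : R) = (fun n => (u n)%:R) by apply/funext => n; rewrite tE.
split.
  exists b, b, c, 3%N; split; first by split=> //; apply: leq_trans b8.
  rewrite -/t; split; first split.
  - by move=> n; apply: ltW.
  - by exists 0%N.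
  - by exists A, B.
  split; first split.
  - rewrite rhoE; apply: cvg_radius_exp uc' _ => //; apply: le_lt_trans binv.
    rewrite lef_pV2 ?posrE ?exprn_gt0 ?ltr0n //.
    by rewrite -{1}[b%:R]expr1 ler_weXn2l // ler1n.
  (* This needs 2 <= 8^(n-2) and n + 1 <= 6 (n - 2), both true from n = 3 on. *)
  - move=> n n3; rewrite tE ltz_nat; apply: (leq_trans (uc n)).
    rewrite /b expnMn -expnM leq_mul //; last by rewrite leq_pexp2l //; lia.
    by rewrite (@leq_trans (8 ^ 1)) // leq_pexp2l //; lia.
  - by rewrite rhoE; apply: cvg_radius_exp uc' _.
  - move=> n n1; rewrite tE; apply: exp_lt_powR_third.
    (* The cube is [8 c^(3n+3)], at most [8^n c^(6n)], with equality at n = 1: this dictates the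
       base [8 c^6]. *)
    apply: (@leq_trans ((2 * c ^ n.+1) ^ 3)); first by rewrite ltn_exp2r.
    rewrite /b 2!expnMn -!expnM; apply: leq_mul; last by rewrite leq_pexp2l //; lia.
    by rewrite -[(2 ^ 3)%N]/(8 ^ 1)%N leq_pexp2l.
  split=> // Ap Am Bp Bm /sEE iw; split=> // r r3.
  by apply: iw; apply: leq_trans r3.
have [Ap [Am [Bp [Bm /digit iw]]]] := iw_ex.
have [T TE] := digit_aterm _ _ _ _ _ _ b0 iw.
(* [T] has value t(n) at every n, including n = 0, and the second term is [c^(n+1)]. *)
exists T, (AExp (ANat 1 c) (AAdd (AVar ord0) (ANat 1 1))) => n.
by rewrite TE /= addn1; apply: sE.
Qed.
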